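(* Let $T$ be a nontrivial tree. For every execution of Algorithm 1 on $T$ (any choice of balanced edges), the output coloring is a conflict-free connection coloring of $T$. Moreover, $cfc(T)\le D(T)$, where $D(T)$ is the minimum of the depths $d(T)$ over all executions of Algorithm 1 on $T$.
   Context: For an edge-colored graph, a path is conflict-free if some color occurs on exactly one of its edges; a conflict-free connection coloring of a connected graph is an edge-coloring in which every pair of distinct vertices is joined by a conflict-free path, and $cfc(G)$ is the minimum number of colors in such a coloring. For a tree $T$, an edge $e$ is balanced if the absolute difference of the numbers of edges of the two components of $T-e$ is minimum among all edges of $T$. Algorithm 1: start with the forest $F=T$. While $F$ has a component with more than one vertex, perform an iteration: simultaneously, from each component of $F$ with more than one vertex, delete one balanced edge (balanced with respect to that component); an edge deleted in the $i$-th iteration is colored $i$. The output is this coloring of $E(T)$; the depth $d(T)$ of the execution is the number of iterations performed. *)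

(* Defs.v *)
From mathcomp Require Import all_boot ssrint.
From mathcomp Require Import boolp.

Set Implicit Arguments.
Unset Strict Implicit.
Unset Printing Implicit Defensive.

Import IntDist.

(* A graph on the vertex set V is given by its set of edges, an edge being the *)
(* unordered pair of its endpoints; deleting edges keeps all the vertices.     *)
Notation graph V := {set {set V}}.

Section Graphs.

Variable V : finType.
Implicit Types (G F D : graph V) (a : {set V}) (x y u v : V) (p : seq V).
Implicit Types (c : {set V} -> nat) (s : seq (graph V)).

Definition simple_graph G : Prop := {in G, forall a, #|a| = 2}.

Definition adj G : rel V := [rel x y | [set x; y] \in G].

Definition connected_graph G : Prop := forall x y, connect (adj G) x y.

Definition acyclic_graph G : Prop :=
  forall p, 2 < size p -> ~ ucycle (adj G) p.

Definition tree G : Prop :=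
  [/\ simple_graph G, connected_graph G & acyclic_graph G].

Definition component G x : {set V} := [set y | connect (adj G) x y].

Definition component_edges G x : graph V :=
  [set a in G | a \subset component G x].

Definition path_edges x p : seq {set V} := pairmap (fun u v => [set u; v]) x p.

(* The path is x :: p, and the color k occurs exactly once on its edges. *)
Definition conflict_free c x p : Prop :=
  exists k, count (fun a => c a == k) (path_edges x p) = 1.

(* Only the values of c on the edges of G matter. *)
Definition cf_connection_coloring G c : Prop :=
  forall x y, x != y ->
  exists p, [/\ path (adj G) x p, uniq (x :: p), last x p = y &
                conflict_free c x p].

Definition num_colors G c : nat := size (undup [seq c a | a in G]).

(* The junk value 0 is returned when P holds nowhere. *)
Definition nat_min (P : nat -> Prop) : nat :=
  if pselect (exists n, `[< P n >]) is left exP then ex_minn exP else 0.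

Definition cfc G : nat :=
  nat_min (fun k => exists2 c, cf_connection_coloring G c & num_colors G c = k).

(* When G is a tree and uv one of its edges, the two components of G - uv are  *)
(* those of u and of v.                                                        *)
Definition imbalance G u v : nat :=
  let F := G :\ [set u; v] in
  `|#|component_edges F u| - #|component_edges F v| |%N.

Definition balanced G a : Prop :=
  a \in G /\
  exists x y, a = [set x; y] /\
    forall u v, [set u; v] \in G -> imbalance G x y <= imbalance G u v.

Definition nontrivial_component F x : bool := 1 < #|component F x|.

(* D is a possible set of edges to delete from the forest F in one iteration:  *)
(* it has exactly one edge in each component of F with more than one vertex,   *)
(* balanced in the graph formed by the edges of that component.                *)
Definition iteration F D : Prop :=
  D \subset F /\
  forall x, nontrivial_component F x ->
  exists2 a, D :&: component_edges F x = [set a] &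
             balanced (component_edges F x) a.

(* s lists the sets of edges deleted in the successive iterations from F.      *)
Fixpoint execution F s : Prop :=
  match s with
  | [::] => forall x, ~~ nontrivial_component F x
  | D :: s' => [/\ exists x, nontrivial_component F x, iteration F D &
                   execution (F :\: D) s']
  end.

Definition depth s : nat := size s.

(* Iterations are numbered from 1. *)
Definition output_coloring s : {set V} -> nat :=
  fun a => (find (fun D => a \in D) s).+1.

Definition min_depth G : nat :=
  nat_min (fun d => exists2 s, execution G s & depth s = d).

End Graphs.

(* The minima defining cfc and min_depth are attained, so that the junk value  *)
(* of nat_min plays no role.                                                   *)
Section Minima.

Lemma nat_minP (P : nat -> Prop) : (exists n, P n) ->
  P (nat_min P) /\ forall m, P m -> nat_min P <= m.
Proof.
case=> n Pn; rewrite /nat_min; case: pselect => [exP|[]]; last first.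
  by exists n; apply/asboolP.
case: ex_minnP => m /asboolP Pm min_m; split=> // k Pk.
by apply: min_m; apply/asboolP.
Qed.

Variable V : finType.
Implicit Types (G F D : graph V) (x y u v : V) (p : seq V).

Lemma adj_sym G : symmetric (adj G).
Proof. by move=> x y; rewrite /adj /= setUC. Qed.

Lemma cfcP G : connected_graph G ->
  (exists2 c, cf_connection_coloring G c & num_colors G c = cfc G) /\
  (forall c, cf_connection_coloring G c -> cfc G <= num_colors G c).
Proof.
move=> connG.
pose P k := exists2 c, cf_connection_coloring G c & num_colors G c = k.
suff /nat_minP[Pm min_m]: exists k, P k.
  by split=> // c cfc_c; apply: min_m; exists c.
pose c (a : {set V}) : nat := enum_rank a.
exists (num_colors G c), c => // x y neq_xy.
have /connectP[p0 path_p0 def_y] := connG x y.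
case/shortenP: path_p0 def_y => p path_p uniq_p _ def_y.
exists p; split=> //; case: p path_p uniq_p def_y => [|z p] /= _ uniq_p def_y.
  by rewrite def_y eqxx in neq_xy.
exists (c [set x; z]); rewrite /= eqxx -[RHS]addn0; congr (_ + _).
apply/eqP; rewrite -leqn0 leqNgt -has_count.
apply/hasPn=> a a_p; rewrite /c (inj_eq val_inj) (inj_eq enum_rank_inj).
apply: contraTneq uniq_p => def_a; rewrite negb_and negbK.
suff in_a w q: a \in path_edges w q -> a \subset w :: q.
  have/in_a/subsetP/(_ x) := a_p; rewrite def_a !inE eqxx => /(_ isT).
  by move=> ->.
elim: q w => //= z' q IHq w; rewrite inE => /orP[/eqP->|/IHq/subset_trans->] //.
  by apply/subsetP=> t; rewrite !inE => /orP[]->; rewrite ?orbT.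
by apply/subsetP=> t; rewrite !inE => ->; rewrite orbT.
Qed.

Lemma component_eq G x y : y \in component G x -> component G y = component G x.
Proof.
rewrite inE => xy; apply/setP=> z; rewrite !inE.
by rewrite (same_connect (sym_connect_sym (@adj_sym G)) xy).
Qed.

Lemma balanced_exists G : simple_graph G -> G != set0 ->
  exists a, balanced G a.
Proof.
move=> simG /set0Pn[a Ga].
have /eqP/cards2P[x [y [_ def_a]]] := simG a Ga.
have Gxy : [set (x, y).1; (x, y).2] \in G by rewrite -def_a.
case: (@arg_minnP _ (x, y) (fun w => [set w.1; w.2] \in G)
         (fun w => imbalance G w.1 w.2) Gxy) => -[u v] /= Guv min_uv.
exists [set u; v]; split=> //; exists u, v; split=> // u' v' Guv'.
exact: (min_uv (u', v')).
Qed.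

Lemma component_edges_neq0 G x : nontrivial_component G x ->
  component_edges G x != set0.
Proof.
case/card_gt1P=> y [z [xy xz neq_yz]].
have{xy xz neq_yz}: exists2 w, w \in component G x & x != w.
  by have [eq_xy|] := eqVneq x y; [exists z; rewrite // eq_xy | exists y].
case=> w; rewrite inE => /connectP[[|t p] /=]; first by move=> _ ->; rewrite eqxx.
case/andP=> xt _ _ _; apply/set0Pn; exists [set x; t].
rewrite inE [_ \in G]xt /=; apply/subsetP=> r; rewrite !inE.
by case/orP=> /eqP->; rewrite ?connect0 ?connect1.
Qed.

Lemma iteration_exists G : simple_graph G -> exists D, iteration G D.
Proof.
move=> simG; have simC x : simple_graph (component_edges G x).
  by move=> a; rewrite inE => /andP[/simG].
have /choice[f fP] (H : graph V) : exists a,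
    simple_graph H -> H != set0 -> balanced H a.
  have [[simH H0]|notH] := pselect (simple_graph H /\ H != set0).
    by have [a] := balanced_exists simH H0; exists a.
  by exists set0 => simH H0; case: notH.
have{}fP x : nontrivial_component G x ->
    balanced (component_edges G x) (f (component_edges G x)).
  by move/component_edges_neq0; apply: fP.
exists [set f (component_edges G x) | x in nontrivial_component G]; split.
  by apply/subsetP=> _ /imsetP[x /fP[+ _] ->]; rewrite inE => /andP[].
move=> x ntx; exists (f (component_edges G x)); last exact: fP.
apply/setP=> a; rewrite [in LHS]inE [in RHS]inE.
apply/andP/eqP=> [[/imsetP[y nty ->] in_x] | ->]; last first.
  by split; [apply/imsetP; exists x | case: (fP x ntx)].
have [in_y _] := fP y nty; set b := f _ in in_x in_y *.
have [z bz] : exists z, z \in b.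
  by apply/set0Pn; rewrite -card_gt0 (simC x b in_x).
have sub w : b \in component_edges G w -> z \in component G w.
  by rewrite inE => /andP[_ /subsetP]; apply.
by rewrite /b /component_edges -(component_eq (sub y in_y)) (component_eq (sub x in_x)).
Qed.

Lemma execution_exists G : simple_graph G -> exists s, execution G s.
Proof.
have [n] := ubnP #|G|; elim: n G => // n IHn G leGn simG.
have [[x ntx]|triv] := pselect (exists x, nontrivial_component G x); last first.
  by exists [::] => x; apply/negP=> ntx; case: triv; exists x.
have [D itD] := iteration_exists simG.
have [sDG /(_ x ntx)[a defD _]] := itD.
have Da : a \in D by have := set11 a; rewrite -defD => /setIP[].
have [||s ex_s] := IHn (G :\: D); last by exists (D :: s); split=> //; exists x.
  rewrite (leq_trans _ (_ : #|G| <= n)) // proper_card //.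
  apply/properP; split; first exact: subsetDl.
  by exists a; rewrite ?inE ?Da // (subsetP sDG).
by move=> b /setDP[/simG].
Qed.

Lemma min_depthP G : simple_graph G ->
  (exists2 s, execution G s & depth s = min_depth G) /\
  (forall s, execution G s -> min_depth G <= depth s).
Proof.
move=> simG; pose P d := exists2 s, execution G s & depth s = d.
suff /nat_minP[Pm min_m]: exists d, P d.
  by split=> // s ex_s; apply: min_m; exists s.
by have [s ex_s] := execution_exists simG; exists (depth s), s.
Qed.

End Minima.

(* Main.v *)
Require Import Defs.
From mathcomp Require Import all_boot.

(** While a path survives in the forest, all of its edges lie in one component,
    so the first iteration that deletes some edge of the path deletes exactly
    one: its color occurs once on the path. Each edge is deleted by some
    iteration, so an execution uses at most as many colors as its depth. *)

Section Executions.

Set Implicit Arguments.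
Unset Strict Implicit.
Unset Printing Implicit Defensive.

Variable V : finType.
Implicit Types (F D : graph V) (s : seq (graph V)) (x y : V) (p : seq V).

Lemma path_edge_subset x p a : a \in path_edges x p -> a \subset x :: p.
Proof.
elim: p x => //= y p IHp x; rewrite inE => /orP[/eqP->|/IHp/subset_trans->//].
  by apply/subsetP=> z; rewrite !inE => /orP[]->; rewrite ?orbT.
by apply/subsetP=> z; rewrite !inE => ->; rewrite orbT.
Qed.

(** The first edge contains [x], while every later edge lies inside [p], which avoids [x]. *)
Lemma uniq_path_edges x p : uniq (x :: p) -> uniq (path_edges x p).
Proof.
elim: p x => //= y p IHp x /andP[x_p uniq_p]; rewrite IHp // andbT.
apply: contra x_p => /path_edge_subset/subsetP; apply.
by rewrite !inE eqxx.
Qed.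

Lemma path_edges_adj F x p :
  path (adj F) x p = all (fun a => a \in F) (path_edges x p).
Proof. by elim: p x => //= y p IHp x; rewrite IHp. Qed.

(** Confining the path to one component lets a single iteration delete at most one of its edges. *)
Lemma path_edges_component F x p :
  path (adj F) x p -> {subset path_edges x p <= component_edges F x}.
Proof.
move=> path_p a a_p; rewrite inE.
move: (path_p); rewrite path_edges_adj => /allP->//=.
apply: subset_trans (path_edge_subset a_p) _.
by apply/subsetP=> y /(path_connect path_p); rewrite inE.
Qed.

Lemma edge_nontrivial F x y :
  x != y -> [set x; y] \in F -> nontrivial_component F x.
Proof.
move=> neq_xy Fxy; apply/card_gt1P; exists x, y.
by rewrite !inE connect0 (connect1 (_ : adj F x y)).
Qed.

Lemma nontrivial_path F x p :
  path (adj F) x p -> uniq (x :: p) -> p != [::] -> nontrivial_component F x.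
Proof.
case: p => //= y p /andP[Fxy _]; rewrite inE negb_or -andbA.
by case/andP=> neq_xy _ _; apply: edge_nontrivial Fxy.
Qed.

Lemma output_coloring_cons D s a :
  output_coloring (D :: s) a = if a \in D then 1 else (output_coloring s a).+1.
Proof. by rewrite /output_coloring /=; case: ifP. Qed.

Lemma execution_conflict_free F s x p : execution F s ->
  path (adj F) x p -> uniq (x :: p) -> p != [::] ->
  conflict_free (output_coloring s) x p.
Proof.
move=> ex_s path_p uniq_p p_nil.
elim: s F ex_s path_p => [|D s IHs] F ex_s path_p;
  have ntx := nontrivial_path path_p uniq_p p_nil.
  by have := ex_s x; rewrite ntx.
case: ex_s => _ [_ /(_ x ntx)[a defD _]] ex_s.
have [/hasP[b b_p Db] | noD] := boolP (has (fun b => b \in D) (path_edges x p)).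
  (* On the component of [x], which contains the path, [D] reduces to the single edge [a]. *)
  have onlya b' : b' \in path_edges x p -> (b' \in D) = (b' == a).
    move/(path_edges_component path_p) => Cb'.
    by rewrite -in_set1 -defD inE Cb' andbT.
  (* Color 1 marks exactly the edges of [D]: any edge outside [D] gets a color of at least 2. Since
     the path repeats no edge, [a] is counted once. *)
  exists 1; rewrite (@eq_in_count _ _ (pred1 a)); last first.
    by move=> b' /onlya/= <-; rewrite output_coloring_cons; case: ifP.
  by rewrite count_uniq_mem ?uniq_path_edges // -(eqP (_ : b == a)) ?b_p -?onlya.
(* No edge of the path is deleted, so the path survives in [F :\: D]; prepending [D] shifts its
   colors by one. *)
have [|k one_k] := IHs _ ex_s.
  rewrite path_edges_adj; apply/allP=> b b_p; rewrite inE (hasPn noD) //=.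
  by move: path_p; rewrite path_edges_adj => /allP->.
exists k.+1; rewrite -one_k; apply: eq_in_count => b b_p.
by rewrite output_coloring_cons (negPf (hasPn noD b b_p)).
Qed.

(** An edge that was never deleted would join two distinct vertices of the final forest, whose
    components are all trivial. *)
Lemma execution_exhaustive F s a :
  simple_graph F -> execution F s -> a \in F -> has (fun D => a \in D) s.
Proof.
elim: s F => [|D s IHs] F simF /= ex_s Fa.
  have /eqP/cards2P[x [y [neq_xy def_a]]] := simF a Fa.
  by have := ex_s x; rewrite (edge_nontrivial neq_xy) // -def_a.
case: ex_s => _ _ ex_s; case: (boolP (a \in D)) => //= notDa.
apply: IHs ex_s _; last by rewrite inE notDa.
by move=> b /setDP[/simF].
Qed.

Lemma num_colors_execution F s :
  simple_graph F -> execution F s -> num_colors F (output_coloring s) <= depth s.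
Proof.
move=> simF ex_s; rewrite /num_colors /depth -[leqRHS](size_iota 1).
apply: uniq_leq_size (undup_uniq _) _ => k; rewrite mem_undup.
case/imageP=> a Fa ->.
(* An edge missing from every set of [s] would get the default color [(size s).+1], just out of
   range; exhaustiveness excludes this. *)
by rewrite mem_iota /= add1n ltnS -has_find (execution_exhaustive simF ex_s).
Qed.

Lemma execution_cf_coloring F s : connected_graph F -> execution F s ->
  cf_connection_coloring F (output_coloring s).
Proof.
move=> connF ex_s x y neq_xy; have /connectP[p0 path_p0 def_y] := connF x y.
case/shortenP: path_p0 def_y => p path_p uniq_p _ def_y.
exists p; split=> //; apply: execution_conflict_free ex_s path_p uniq_p _.
by apply: contraNneq neq_xy => p0_nil; rewrite def_y p0_nil.
Qed.

End Executions.

Theorem theorem3p4 (V : finType) (T : graph V)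
    (treeT : tree T) (nontrivialT : 1 < #|V|) :
  (forall s : seq (graph V), execution T s ->
     cf_connection_coloring T (output_coloring s)) /\
  cfc T <= min_depth T.
Proof.
have [simT connT _] := treeT.
split=> [s|]; first exact: execution_cf_coloring.
(* An execution of minimum depth is itself a coloring that bounds [cfc T]. *)
have [[s ex_s <-] _] := min_depthP simT.
have [_ min_cfc] := cfcP connT.
apply: leq_trans (num_colors_execution simT ex_s).
exact/min_cfc/execution_cf_coloring.
Qed.
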